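(* Let $S$ be a set system with ground set $[n]$, let $g\in\mathcal{G}$, and let $\mu\in S_n$ be a permutation. Then the following are equivalent: (1) There exists a set system $D\in\operatorname{Orb}(S)$ that is self-$\hat g$ via the permutation $\mu$, where $\hat g=(g,g,\dots,g)\in\mathcal{G}^n$ is uniform. (2) For every set system $D'\in\operatorname{Orb}(S)$, $D'$ is self-$\hat g'$ via $\mu'$ for some $\hat g'=(g_1,g_2,\dots,g_n)\in\mathcal{G}^n$ and $\mu'\in S_n$, where $\mu'=\pi\mu\pi^{-1}$ for some $\pi\in S_n$, and $\hat g'$ satisfies the following condition: if $C=(c_1,c_2,\dots,c_m)$ is a cycle in the cycle decomposition of $\mu'$, then $$\left|\,g_{c_m}g_{c_{m-1}}\cdots g_{c_1}\right|=|g^m|.$$ (3) There exists a set system $D'\in\operatorname{Orb}(S)$ that is self-$\hat g'$ via $\mu'$ for some $\hat g'=(g_1,g_2,\dots,g_n)\in\mathcal{G}^n$, where $\mu'=\mu$, and $\hat g'$ satisfies the following condition: if $C=(c_1,c_2,\dots,c_m)$ is a cycle in the cycle decomposition of $\mu'$, then $$\left|\,g_{c_m}g_{c_{m-1}}\cdots g_{c_1}\right|=|g^m|.$$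
   Context: A set system with ground set $[n]=\{1,\dots,n\}$ is a pair $D=([n],\mathcal{F})$ with $\mathcal{F}$ any collection of subsets of $[n]$. For $i\in[n]$: the twist is $D\ast i=([n],\{X\triangle\{i\}: X\in\mathcal{F}\})$; the loop complementation is $D+i=([n],\mathcal{F}\triangle\{I\cup\{i\}: I\in\mathcal{F},\ i\notin I\})$. For fixed $i$ these satisfy the relations of $\mathcal{G}=\langle \ast,+\mid \ast^2,+^2,(\ast+)^3\rangle\cong S_3$. For a word $g=g_1\cdots g_k$ in $\{\ast,+\}$, $D\,g\,i:=(\cdots(D\,g_k\,i)\cdots)\,g_1\,i$ (rightmost letter first). Operations on distinct elements commute. An element $\hat g=(g_1,\dots,g_n)\in\mathcal{G}^n$ is viewed as a map $[n]\to\mathcal{G}$; $\circ$ is componentwise multiplication. $\hat g\cdot D$ is obtained by applying $g_i$ to element $i$ for all $i$. For $\pi\in S_n$, $D_\pi=([n],\{\pi(I): I\in\mathcal{F}\})$, and $\hat g\pi^{-1}$ denotes the reindexing $(\hat g\pi^{-1})(i)=g_{\pi^{-1}(i)}$. The semidirect product $\mathcal{G}^n\rtimes_\phi S_n$, with $\phi_\pi(\hat g)=\hat g\pi^{-1}$, has multiplication $(\hat g,\pi_1)(\hat h,\pi_2)=(\hat g\circ\hat h\pi_1^{-1},\pi_1\pi_2)$ and acts on set systems on $[n]$ by $(\hat g,\pi)D=\hat g\cdot D_\pi$. $\operatorname{Orb}(S)$ is the orbit of $S$ under this action. A set system $D$ on $[n]$ is self-$\hat g$ via $\pi$ (where $\hat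 g\in\mathcal{G}^n$, $\pi\in S_n$) if $\hat g$ is not the identity of $\mathcal{G}^n$ and $(\hat g,\pi)D=D$. An element $\hat g\in\mathcal{G}^n$ is uniform if all its entries are the same and this common entry is a non-identity element of $\mathcal{G}$. $|x|$ denotes the order of $x\in\mathcal{G}$. A cycle $(c_1,\dots,c_m)$ of a permutation $\mu$ means $\mu(c_i)=c_{i+1}$ with indices mod $m$; fixed points count as cycles of length $1$ in the cycle decomposition.
   Formalization: The formal theorem assumes n ≥ 1 and g not the identity, and in (2) allows ĝ' to be the identity (only (ĝ',μ')D'=D' is required); as written the equivalence fails, e.g. for n=3, g=∗+, μ=(1 2 3), D'={∅,{1,2,3}}. *)

(* Defs.v *)
From mathcomp Require Import all_boot all_fingroup all_solvable.

Set Implicit Arguments.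
Unset Strict Implicit.
Unset Printing Implicit Defensive.

Import GroupScope.

(* The group of the presentation with generators s (the twist) and t (the loop
   complementation) and relators s^2, t^2, (st)^3, realised as the symmetric
   group of degree 3; calG_presentation below justifies this choice. *)
Definition calG := {perm 'I_3}.

Inductive letter := Star | Plus.

Definition gen (a : letter) : calG :=
  match a with
  | Star => tperm (inord 0) (inord 1)
  | Plus => tperm (inord 1) (inord 2)
  end.

Definition evalw (w : seq letter) : calG := \prod_(a <- w) gen a.

Definition nwords : seq (seq letter) :=
  [:: [::]; [:: Star]; [:: Plus]; [:: Star; Plus]; [:: Plus; Star];
      [:: Star; Plus; Star]].

(* Some word representing g; by gactE below its choice is immaterial. *)
Definition word_of (g : calG) : seq letter :=
  nth [::] nwords (find (fun w => evalw w == g) nwords).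

(* A set system on [n] is represented by its family of sets; the point k of
   [n] = {1, ..., n} is the ordinal k - 1. *)
Notation setsys n := {set {set 'I_n}}.

Definition symdiff (T : finType) (A B : {set T}) : {set T} :=
  (A :\: B) :|: (B :\: A).

Section SetSystems.
Variable n : nat.
Implicit Types (D S : setsys n) (i : 'I_n) (X : {set 'I_n}).

Definition twist i D : setsys n := [set symdiff X [set i] | X in D].

Definition loopc i D : setsys n :=
  symdiff D [set X :|: [set i] | X in D & i \notin X].

Definition lact (a : letter) i D : setsys n :=
  match a with Star => twist i D | Plus => loopc i D end.

(* foldr: the rightmost letter acts first. *)
Definition wact (w : seq letter) i D : setsys n :=
  foldr (fun a => lact a i) D w.

Definition gact (g : calG) i D : setsys n := wact (word_of g) i D.

(* The order of the factors is immaterial by gact_comm. *)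
Definition vact (gh : {ffun 'I_n -> calG}) D : setsys n :=
  foldr (fun i => gact (gh i) i) D (enum 'I_n).

Definition permsys (pi : 'S_n) D : setsys n :=
  [set pi @: X | X : {set 'I_n} in D].

(* The action of the element (gh, pi) of the semidirect product. *)
Definition sdact (gh : {ffun 'I_n -> calG}) (pi : 'S_n) D : setsys n :=
  vact gh (permsys pi D).

Definition Orb S : {set setsys n} :=
  [set sdact x.1 x.2 S | x : {ffun 'I_n -> calG} * 'S_n].

Definition self_via (gh : {ffun 'I_n -> calG}) (pi : 'S_n) D : Prop :=
  gh != [ffun=> 1] /\ sdact gh pi D = D.

Definition uniform (gh : {ffun 'I_n -> calG}) : Prop :=
  exists2 h : calG, h != 1 & gh = [ffun=> h].

(* Here c = (c_1, ..., c_m) is a nonempty duplicate-free sequence with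
   mu c_i = c_{i+1}, indices mod m. Every rotation of a cycle is allowed; all
   of them give conjugate products. *)
Definition cycle_of_perm (mu : 'S_n) (c : seq 'I_n) : Prop :=
  c != [::] /\ ufcycle mu c.

(* rev c, since the product is g_{c_m} ... g_{c_1}. *)
Definition cycle_condition (g : calG) (gh : {ffun 'I_n -> calG})
    (mu : 'S_n) : Prop :=
  forall c : seq 'I_n, cycle_of_perm mu c ->
    #[\prod_(i <- rev c) gh i] = #[g ^+ size c].

End SetSystems.

Lemma gen2 a : gen a * gen a = 1.
Proof. by case: a; rewrite /= tperm2. Qed.

Lemma inord3 : [/\ inord 0 != inord 1 :> 'I_3, inord 0 != inord 2 :> 'I_3
                 & inord 1 != inord 2 :> 'I_3].
Proof. by split; rewrite -val_eqE /= !inordK. Qed.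

Lemma gen_braid : gen Star * gen Plus * gen Star = gen Plus * gen Star * gen Plus.
Proof.
have [n01 n02 n12] := inord3.
have E (x y : calG) : x * x = 1 -> x * y * x = y ^ x.
  by move=> x2; rewrite conjgE -mulgA; congr (_ * _); apply/eqP;
     rewrite eq_sym eq_invg_mul x2.
rewrite !E ?gen2 //= !tpermJ tpermL tpermR.
by rewrite (tpermD n02 n12) tpermD // eq_sym.
Qed.

Lemma evalw_uniq : uniq [seq evalw w | w <- nwords].
Proof.
have [n01 n02 n12] := inord3.
have p0 : gen Plus (inord 0) = inord 0 by rewrite tpermD // eq_sym.
have s2 : gen Star (inord 2) = inord 2 by rewrite tpermD // eq_sym.
have s0 : gen Star (inord 0) = inord 1 by rewrite tpermL.
have s1 : gen Star (inord 1) = inord 0 by rewrite tpermR.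
have p1 : gen Plus (inord 1) = inord 2 by rewrite tpermL.
have p2 : gen Plus (inord 2) = inord 1 by rewrite tpermR.
pose f (s : calG) : nat * nat := (val (s (inord 0)), val (s (inord 1))).
apply: (@map_uniq _ _ f); rewrite /= /f /evalw !big_cons !big_nil !mulg1.
do !rewrite ?permM ?perm1 ?p0 ?p1 ?p2 ?s0 ?s1 ?s2.
by rewrite /= !inordK.
Qed.

Lemma evalwK g : evalw (word_of g) = g.
Proof.
have sub : {subset [seq evalw w | w <- nwords] <= enum calG}.
  by move=> x _; rewrite mem_enum.
have szle : size (enum calG) <= size [seq evalw w | w <- nwords].
  by rewrite -cardE card_Sn.
have inG : g \in [seq evalw w | w <- nwords].
  by rewrite (uniq_min_size evalw_uniq sub szle).2 mem_enum.
have hg : has (fun w => evalw w == g) nwords by rewrite -has_pred1 has_map in inG.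
exact/eqP/(nth_find [::] hg).
Qed.

Lemma calG_presentation :
  [set: calG] \isog Grp (s : t : (s ^+ 2, t ^+ 2, (s * t) ^+ 3)).
Proof.
have isoD6 := @Grp'_dihedral 3 isT.
apply: isoGrp_trans (isoD6).
apply/(isoGrpP _ isoD6); rewrite (@card_dihedral 3) //; split.
  by rewrite cardsT card_Sn.
have key (s t : calG) : <[s]> <*> <[t]> = [set: calG] -> s ^+ 2 = 1 ->
    t ^+ 2 = 1 -> (s * t) ^+ 3 = 1 ->
    [set: calG] \homg Grp (s : t : (s ^+ 2, t ^+ 2, (s * t) ^+ 3)).
  move=> gn s2 t2 st3; apply/existsP; exists (s, t) => /=.
  by rewrite gn s2 t2 st3.
apply: (key (gen Star) (gen Plus)).
- apply/eqP; rewrite -subTset; apply/subsetP=> g _; rewrite -(evalwK g).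
  apply: group_prod => -[] _.
    exact: subsetP (joing_subl _ _) _ (cycle_id _).
  exact: subsetP (joing_subr _ _) _ (cycle_id _).
- exact: gen2.
- exact: gen2.
rewrite 2!expgS expg1 !mulgA gen_braid -!mulgA (mulgA (gen Plus) (gen Plus)).
by rewrite gen2 mul1g (mulgA (gen Star) (gen Star)) gen2 mul1g gen2.
Qed.

Section Facts.
Variable n : nat.
Implicit Types (D S : setsys n) (i : 'I_n) (X : {set 'I_n}).

Let tog i X := symdiff X [set i].

Lemma in_symdiff (T : finType) (A B : {set T}) x :
  (x \in symdiff A B) = (x \in A) (+) (x \in B).
Proof. by rewrite !inE; case: (x \in A); case: (x \in B). Qed.

Let togK i : involutive (tog i).
Proof. by move=> X; apply/setP=> x; rewrite !in_symdiff -addbA addbb addbF. Qed.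

Let in_tog i X : (i \in tog i X) = (i \notin X).
Proof. by rewrite in_symdiff set11 addbT. Qed.

Let in_togN i j X : i != j -> (j \in tog i X) = (j \in X).
Proof. by move=> ij; rewrite in_symdiff !inE eq_sym (negPf ij) addbF. Qed.

Let togC i j X : tog i (tog j X) = tog j (tog i X).
Proof. by apply/setP=> x; rewrite !in_symdiff -!addbA [in X in _ (+) X]addbC. Qed.

Lemma in_twist i D X : (X \in twist i D) = (symdiff X [set i] \in D).
Proof.
apply/imsetP/idP=> [[Y YD ->]|XD]; first by rewrite -/(tog i _) -/(tog i _) togK.
by exists (tog i X); rewrite // -/(tog i _) togK.
Qed.

Lemma in_loopc i D X :
  (X \in loopc i D) = (X \in D) (+) ((i \in X) && (symdiff X [set i] \in D)).
Proof.
rewrite in_symdiff; congr (_ (+) _).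
apply/imsetP/andP=> [[Y]|[iX XD]].
  rewrite inE => /andP[YD iY] ->; rewrite !inE eqxx orbT; split=> //.
  suff -> : symdiff (Y :|: [set i]) [set i] = Y by [].
  apply/setP=> x; rewrite in_symdiff !inE; case: eqVneq => [->|_].
    by rewrite (negPf iY).
  by rewrite orbF addbF.
exists (symdiff X [set i]); first by rewrite inE XD in_tog iX.
apply/setP=> x; rewrite !inE; case: eqVneq => [->|_]; first by rewrite orbT iX.
by case: (x \in X).
Qed.

Lemma lact2 a i D : lact a i (lact a i D) = D.
Proof.
apply/setP=> X; case: a => /=; rewrite ?in_twist ?in_loopc -!/(tog i _).
  by rewrite togK.
by rewrite ?in_loopc -!/(tog i _) in_tog togK;
   case: (i \in X); rewrite /= ?addbF // -addbA addbb addbF.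
Qed.

Lemma lact_braid i D :
  lact Star i (lact Plus i (lact Star i D)) =
  lact Plus i (lact Star i (lact Plus i D)).
Proof.
apply/setP=> X /=; do !rewrite ?in_twist ?in_loopc -?/(tog i _) ?in_tog ?togK.
by case: (i \in X); case: (X \in D); case: (tog i X \in D).
Qed.

Lemma lactC a b i j D : i != j ->
  lact a i (lact b j D) = lact b j (lact a i D).
Proof.
move=> ij; have ji: j != i by rewrite eq_sym.
apply/setP=> X; case: a; case: b => /=;
  do !rewrite ?in_twist ?in_loopc -?/(tog i _) -?/(tog j _)
     ?(in_togN _ ij) ?(in_togN _ ji) ?(togC i j) //.
by case: (i \in X); case: (j \in X); case: (X \in D); case: (tog i X \in D);
   case: (tog j X \in D); case: (tog j (tog i X) \in D).
Qed.

Lemma wact_cat w w' i D : wact (w ++ w') i D = wact w i (wact w' i D).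
Proof. exact: foldr_cat. Qed.

Let reduce (a : letter) (w : seq letter) : seq letter :=
  match a, w with
  | Star, [::] => [:: Star]
  | Star, [:: Star] => [::]
  | Star, [:: Plus] => [:: Star; Plus]
  | Star, [:: Star; Plus] => [:: Plus]
  | Star, [:: Plus; Star] => [:: Star; Plus; Star]
  | Star, _ => [:: Plus; Star]
  | Plus, [::] => [:: Plus]
  | Plus, [:: Star] => [:: Plus; Star]
  | Plus, [:: Plus] => [::]
  | Plus, [:: Star; Plus] => [:: Star; Plus; Star]
  | Plus, [:: Plus; Star] => [:: Star]
  | Plus, _ => [:: Star; Plus]
  end.

Let norm (w : seq letter) : seq letter := foldr reduce [::] w.

(* Well-definedness: the action of a word depends only on its value. *)
Lemma wactE w w' i D : evalw w = evalw w' -> wact w i D = wact w' i D.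
Proof.
pose nw (v : seq letter) := exists2 k, k < 6 & v = nth [::] nwords k.
have red a v : nw v -> [/\ nw (reduce a v), evalw (reduce a v) = gen a * evalw v
                        & wact (reduce a v) i D = lact a i (wact v i D)].
  case=> k k6 ->; split.
  - rewrite /nw; case: a; case: k k6 => [|[|[|[|[|[|k]]]]]] // _;
       first [by exists 0%N | by exists 1%N | by exists 2 | by exists 3 | by exists 4
             | by exists 5].
  - have s2 := gen2 Star; have p2 := gen2 Plus; have br := gen_braid.
    rewrite /evalw; case: a; case: k k6 => [|[|[|[|[|[|k]]]]]] // _;
      rewrite [nth _ _ _]/= [reduce _ _]/= ?big_cons ?big_nil ?mulg1 //;
      rewrite ?(mulgA (gen Star) (gen Star)) ?(mulgA (gen Plus) (gen Plus))
              ?s2 ?p2 ?mul1g //.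
      by rewrite !mulgA br.
    by rewrite [gen Star * (_ * _)]mulgA br !mulgA p2 mul1g.
  - case: a; case: k k6 => [|[|[|[|[|[|k]]]]]] // _;
      rewrite [nth _ _ _]/= [reduce _ _]/= /wact [foldr _ _ _]/= [in RHS]/foldr;
      rewrite ?(lact2 Star) ?(lact2 Plus) //; do ?exact: lact_braid.
    by rewrite lact_braid (lact2 Plus).
have normP v : [/\ nw (norm v), evalw (norm v) = evalw v
                 & wact (norm v) i D = wact v i D].
  elim: v => [|a v [nv ev av]] /=; first by split=> //; exists 0%N.
  have [H1 H2 H3] := red a _ nv.
  by split; rewrite // ?H2 ?H3 ?av // ev /evalw big_cons.
have [[k k6 nk] ek ak] := normP w; have [[l l6 nl] el al] := normP w'.
move=> eww; rewrite -ak -al nk nl; congr (wact (nth _ _ _) i D).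
apply/eqP; rewrite -(nth_uniq 1 _ _ evalw_uniq) // !(nth_map [::]) //.
by rewrite -nk -nl ek el eww.
Qed.

Lemma gactE w i D : gact (evalw w) i D = wact w i D.
Proof. by apply: wactE; rewrite evalwK. Qed.

Lemma gact1 i D : gact 1 i D = D.
Proof. by have := gactE [::] i D; rewrite /evalw big_nil. Qed.

Lemma gactM g h i D : gact (g * h) i D = gact g i (gact h i D).
Proof.
rewrite -[in LHS](evalwK g) -[in LHS](evalwK h) /evalw -big_cat -/(evalw _).
by rewrite gactE wact_cat.
Qed.

Lemma gact_comm g h i j D : i != j ->
  gact g i (gact h j D) = gact h j (gact g i D).
Proof.
move=> ij; have lw a w E : lact a i (wact w j E) = wact w j (lact a i E).
  by elim: w => //= b w IH; rewrite lactC // IH.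
rewrite /gact; elim: (word_of g) => //= a w ->; exact: lw.
Qed.

End Facts.

(* Under the cycle condition, gh can only be trivial when g ^+ m = 1 for every
   cycle length m of mu; in all other cases invariance under (gh, mu) is the
   same as self_via gh mu. *)
Lemma cycle_condition_neq1 n (g : calG) (gh : {ffun 'I_n -> calG}) (mu : 'S_n)
    (c : seq 'I_n) :
  cycle_condition g gh mu -> cycle_of_perm mu c -> g ^+ size c != 1 ->
  gh != [ffun=> 1].
Proof.
move=> cc /cc oc; apply: contraNneq => gh1; rewrite -order_eq1 -oc gh1.
by rewrite big1 ?order1 // => i _; rewrite ffunE.
Qed.

(* Main.v *)
Require Import Defs.
From mathcomp Require Import all_boot all_fingroup all_solvable.
Set Implicit Arguments.
Unset Strict Implicit.
Unset Printing Implicit Defensive.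
Import GroupScope.

(* Conjugating (g, ..., g; mu) by (h, pi) in the semidirect product gives
   (f, pi mu pi^-1) with f x = h x * g * (h y)^-1, where y is the preimage of x
   under pi mu pi^-1.  Along a cycle of length m this telescopes to a conjugate
   of g ^+ m.  Conversely, if the product of f along each cycle is conjugate to
   g ^+ m, then h can be defined cycle by cycle, starting at a base point with a
   conjugating element and propagating along the cycle; conjugacy in S_3 is
   detected by the order of the elements. *)

(* fingroup.action also defines a gact. *)
Local Notation gact := Defs.gact.

(** * Conjugacy classes of [calG] *)

Lemma calG_enum (x : calG) :
  exists2 k, k < 6 & x = evalw (nth [::] nwords k).
Proof.
rewrite -[x]evalwK /word_of; set k := find _ _.
case: (ltnP k 6) => [k6|k6]; first by exists k.
(* Out of range, [nth] returns its default [[::]], which is also the word of index 0. *)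
by exists 0%N; rewrite // nth_default.
Qed.

Lemma evalw_eq1 k : k < 6 -> (evalw (nth [::] nwords k) == 1) = (k == 0%N).
Proof.
move=> k6; have <- : evalw (nth [::] nwords 0) = 1 by rewrite /evalw big_nil.
by rewrite -(nth_uniq 1 _ _ evalw_uniq) // !(nth_map [::]).
Qed.

Lemma gen_neq1 a : gen a != 1.
Proof.
have := @evalw_eq1 1 isT; have := @evalw_eq1 2 isT.
by case: a; rewrite /evalw /= !big_cons big_nil !mulg1 => E1 E2;
   rewrite ?E1 ?E2.
Qed.

Lemma order_gen a : #[gen a] = 2.
Proof. by apply: nt_prime_order (gen_neq1 a); rewrite // expgS expg1 gen2. Qed.

Lemma order_genM : #[gen Star * gen Plus] = 3.
Proof.
apply: nt_prime_order => //; last first.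
  by have := @evalw_eq1 3 isT; rewrite /evalw /= !big_cons big_nil mulg1 => ->.
rewrite 2!expgS expg1 !mulgA gen_braid -!mulgA (mulgA (gen Plus) (gen Plus)).
by rewrite gen2 mul1g (mulgA (gen Star) (gen Star)) gen2 mul1g gen2.
Qed.

Lemma gen_inv a : (gen a)^-1 = gen a.
Proof. by apply/eqP; rewrite eq_invg_mul gen2. Qed.

(** The representatives are the identity, a transposition and a 3-cycle; their orders 1, 2, 3
    differ, so the order decides conjugacy. *)
Lemma calG_class (x : calG) :
  [\/ x = 1, exists a, x = gen Star ^ a
    | exists a, x = (gen Star * gen Plus) ^ a].
Proof.
have [k k6 ->] := calG_enum x; rewrite /evalw.
case: k k6 => [|[|[|[|[|[|k]]]]]] // _;
  rewrite [nth _ _ _]/= ?big_cons ?big_nil ?mulg1; first by constructor 1.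
- by constructor 2; exists 1; rewrite conjg1.
- constructor 2; exists (gen Plus * gen Star).
  rewrite conjgE invMg !gen_inv !mulgA gen_braid.
  by rewrite -(mulgA (_ * gen Star)) gen2 mulg1 -mulgA gen2 mulg1.
- by constructor 3; exists 1; rewrite conjg1.
- by constructor 3; exists (gen Star); rewrite conjgE gen_inv !mulgA gen2 mul1g.
constructor 2; exists (gen Plus).
by rewrite conjgE gen_inv !mulgA gen_braid.
Qed.

Lemma calG_conj (x y : calG) : #[x] = #[y] -> exists a, x = y ^ a.
Proof.
case: (calG_class x) => [->|[a ->]|[a ->]];
case: (calG_class y) => [->|[b ->]|[b ->]];
rewrite ?order1 ?orderJ ?order_gen ?order_genM // => _.
- by exists 1; rewrite conjg1.
- by exists (b^-1 * a); rewrite -conjgM mulKVg.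
- by exists (b^-1 * a); rewrite -conjgM mulKVg.
Qed.

(** * The action of the semidirect product and its orbits *)

Section Action.
Variable n : nat.
Implicit Types (D S : setsys n) (i : 'I_n) (s t : seq 'I_n).
Implicit Types (f h : {ffun 'I_n -> calG}) (p q : 'S_n).

Lemma foldr_gact_comm (u : 'I_n -> calG) x i s D : i \notin s ->
  gact x i (foldr (fun j => gact (u j) j) D s)
    = foldr (fun j => gact (u j) j) (gact x i D) s.
Proof.
elim: s => //= j s IH; rewrite inE negb_or => /andP[ij /IH <-].
exact: gact_comm.
Qed.

Lemma foldr_gactM (u v : 'I_n -> calG) s D : uniq s ->
  foldr (fun j => gact (u j * v j) j) D s
    = foldr (fun j => gact (u j) j) (foldr (fun j => gact (v j) j) D s) s.
Proof.
elim: s => //= i s IH /andP[iNs us].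
by rewrite IH // Defs.gactM !foldr_gact_comm.
Qed.

(** Operations at distinct points commute. Needed because relabelling by a permutation reorders the
    enumeration used in [vact]. *)
Lemma foldr_gact_perm (u : 'I_n -> calG) s t D : uniq s -> perm_eq s t ->
  foldr (fun j => gact (u j) j) D s = foldr (fun j => gact (u j) j) D t.
Proof.
elim: s t D => [|i s IH] t D us st.
  by move: st; rewrite perm_sym => /perm_nilP->.
have ut : uniq t by rewrite -(perm_uniq st).
have it : i \in t by rewrite -(perm_mem st) mem_head.
case/splitPr: it ut st => t1 t2 ut st.
move: us => /= /andP[iNs us].
have st' : perm_eq s (t1 ++ t2).
  by rewrite -(perm_cons i) (perm_trans st) // -cat1s perm_catCA.
rewrite (IH _ _ us st') !foldr_cat /= foldr_gact_comm //.
by move: ut; rewrite uniq_catC /= mem_cat negb_or => /andP[/andP[]].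
Qed.

Lemma mem_permsys p D (X : {set 'I_n}) : (p @: X \in permsys p D) = (X \in D).
Proof. exact/mem_imset/imset_inj/perm_inj. Qed.

Lemma permsys_lact p a i D :
  permsys p (lact a i D) = lact a (p i) (permsys p D).
Proof.
have tog (X : {set 'I_n}) : symdiff (p @: X) [set p i] = p @: symdiff X [set i].
  apply/setP=> x; rewrite -[x](permKV p) in_symdiff !mem_imset ?in_symdiff;
    try exact: perm_inj.
  by rewrite !inE (inj_eq perm_inj).
apply/setP=> X.
have -> : X = p @: (p^-1 @: X).
  by rewrite -imset_comp (eq_imset _ (permKV p)) imset_id.
rewrite mem_permsys; case: a => /=; rewrite ?in_twist ?in_loopc tog.
  by rewrite !mem_permsys.
by rewrite !mem_permsys mem_imset //; exact: perm_inj.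
Qed.

Lemma permsys_gact p x i D :
  permsys p (gact x i D) = gact x (p i) (permsys p D).
Proof.
by rewrite /gact; elim: (word_of x) => //= a w <-; rewrite permsys_lact.
Qed.

Lemma permsysM p q D : permsys (p * q) D = permsys q (permsys p D).
Proof.
rewrite /permsys -imset_comp; apply: eq_imset => X /=.
by rewrite -imset_comp; apply: eq_imset => x /=; rewrite permM.
Qed.

Lemma permsys1 D : permsys 1 D = D.
Proof.
rewrite /permsys -[RHS]imset_id; apply: eq_imset => X.
by rewrite -[RHS]imset_id; apply: eq_imset => x; rewrite perm1.
Qed.

Lemma vact_permsys p h D :
  permsys p (vact h D) = vact [ffun i => h (p^-1 i)] (permsys p D).
Proof.
rewrite /vact.
have -> : forall s, permsys p (foldr (fun i => gact (h i) i) D s)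
   = foldr (fun i => gact ([ffun i => h (p^-1 i)] i) i) (permsys p D) (map p s).
  by elim=> //= i s <-; rewrite permsys_gact ffunE permK.
apply: foldr_gact_perm.
  by rewrite (map_inj_uniq perm_inj) enum_uniq.
apply: uniq_perm; rewrite ?(map_inj_uniq perm_inj) ?enum_uniq // => x.
by rewrite mem_enum -[x](permKV p) mem_map ?mem_enum //; exact: perm_inj.
Qed.

(** This is the semidirect product law for (f, p)(h, q); [q * p] applies [q] first. *)
Lemma sdactM f p h q D :
  sdact f p (sdact h q D) = sdact [ffun i => f i * h (p^-1 i)] (q * p) D.
Proof.
rewrite /sdact permsysM vact_permsys /vact -foldr_gactM ?enum_uniq //.
by elim: (enum _) => //= i s ->; rewrite !ffunE.
Qed.

Lemma sdact1 D : sdact [ffun=> 1] 1 D = D.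
Proof.
rewrite /sdact permsys1 /vact.
by elim: (enum _) => //= i s ->; rewrite ffunE Defs.gact1.
Qed.

Lemma sdactK h p :
  cancel (sdact h p) (sdact [ffun i => (h (p i))^-1] p^-1).
Proof.
move=> D; rewrite sdactM mulgV -[RHS]sdact1; congr (sdact _ _ D).
by apply/ffunP=> i; rewrite !ffunE invgK mulVg.
Qed.

Lemma sdactKV h p :
  cancel (sdact [ffun i => (h (p i))^-1] p^-1) (sdact h p).
Proof.
move=> D; rewrite sdactM mulVg -[RHS]sdact1; congr (sdact _ _ D).
by apply/ffunP=> i; rewrite !ffunE permKV mulgV.
Qed.

Lemma Orb_sdact h p S D : D \in Orb S -> sdact h p D \in Orb S.
Proof.
case/imsetP=> -[f q] _ ->; rewrite sdactM /=.
by apply/imsetP; eexists (_, _); last reflexivity.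
Qed.

Lemma Orb_trans S D D' : D \in Orb S -> D' \in Orb S ->
  exists h p, D' = sdact h p D.
Proof.
case/imsetP=> -[f q] _ ->; case/imsetP=> -[f' q'] _ -> /=.
do 2!eexists; rewrite -{1}[S](sdactK f q) sdactM; reflexivity.
Qed.

Lemma Orb_refl S : S \in Orb S.
Proof. by apply/imsetP; exists ([ffun=> 1], 1); rewrite // sdact1. Qed.

(** * The conjugation equation and products along cycles *)

(* The hypothesis on f says (f, pi mu pi^-1) = (h, pi) (g, mu) (h, pi)^-1 in
   the semidirect product. *)
Lemma sdact_conj f h (g : calG) (mu pi : 'S_n) D :
  (forall x, h x * g = f x * h ((pi^-1 * mu * pi)^-1 x)) ->
  sdact f (pi^-1 * mu * pi) (sdact h pi D)
    = sdact h pi (sdact [ffun=> g] mu D).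
Proof.
move=> E; rewrite !sdactM -[mu * pi](mulKVg pi) !mulgA.
by congr (sdact _ _ D); apply/ffunP=> x; rewrite !ffunE E.
Qed.

(** Each factor is [h y * g * (h x)^-1] with [x] the predecessor of [y], so neighbouring values of
    [h] cancel. Open paths make the induction possible. *)
Lemma prod_path_conj f h (g : calG) (mu : 'S_n) x c :
  (forall y, h y * g = f y * h (mu^-1 y)) -> fpath mu x c ->
  \prod_(i <- rev c) f i = h (last x c) * g ^+ size c * (h x)^-1.
Proof.
move=> E; elim: c x => [|y c IH] x /=.
  by rewrite big_nil mulg1 mulgV.
case/andP=> /eqP xy /IH; rewrite rev_cons -cats1 big_cat big_seq1 => ->.
have -> : f y = h y * g * (h x)^-1 by rewrite E -xy permK mulgK.
by rewrite /= expgSr !mulgA mulgKV.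
Qed.

Lemma cycle_condition_conj f h (g : calG) (mu : 'S_n) :
  (forall y, h y * g = f y * h (mu^-1 y)) -> cycle_condition g f mu.
Proof.
move=> E [|x c] [] // _ /andP[]; rewrite (cycle_path x) => cyc _.
(* The path starts at the last point of the cycle and ends there too, so the outer factors are
   mutually inverse. *)
rewrite (prod_path_conj E cyc) -[h _ * _ * _]mulgA.
rewrite -{1}[h (last _ _)]invgK -conjgE; exact: orderJ.
Qed.

Lemma cycle_condition_coboundary f (g : calG) (mu : 'S_n) :
  cycle_condition g f mu ->
  exists h, forall y, h y * g = f y * h (mu^-1 y).
Proof.
move=> cc.
(* The orbit is listed from [mu r], so that it ends at [r]: the product transports a value at [r]
   once around the cycle. *)
have ax r : exists a : calG, \prod_(i <- rev (fingraph.orbit mu (mu r))) f i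
    = a * g ^+ fingraph.order mu r * a^-1.
  have mu_inj : injective mu by exact: perm_inj.
  have om : fingraph.order mu (mu r) = fingraph.order mu r.
    by apply: order_id_cycle; apply: cycle_orbit.
  have cyc : cycle_of_perm mu (fingraph.orbit mu (mu r)).
    split; last by rewrite /ucycle cycle_orbit // orbit_uniq.
    by rewrite -size_eq0 size_orbit -lt0n fingraph.order_gt0.
  have := cc _ cyc; rewrite size_orbit om => /calG_conj[a ->].
  by exists a^-1; rewrite conjgE invgK mulgA.
have /fin_all_exists[a aP] := ax.
(* H r k is the value of h at the k-th point of the cycle after r. *)
pose H r k := \prod_(i <- rev (traject mu (mu r) k)) f i * a r * g ^- k.
have HS r k : H r k.+1 * g = f (iter k.+1 mu r) * H r k.
  by rewrite /H trajectSr rev_rcons big_cons -iterSr expgS invMg !mulgA mulgKV.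
(* Consistency after a full turn; the choice of [a r] as conjugating element is what ensures it. *)
have H0 r : H r (fingraph.order mu r) = H r 0%N.
  rewrite /H /= big_nil mul1g invg1 mulg1.
  have -> : traject mu (mu r) (fingraph.order mu r) = fingraph.orbit mu (mu r).
    rewrite /fingraph.orbit order_id_cycle //.
    exact/cycle_orbit/perm_inj.
  by rewrite aP mulgKV mulgK.
pose h := [ffun x => H (froot mu x) (findex mu (froot mu x) x)].
exists h => y; rewrite !ffunE; set z := mu^-1 y.
have -> : y = mu z by rewrite permKV.
have sym : connect_sym (frel mu) by apply: fconnect_sym; exact: perm_inj.
have -> : froot mu (mu z) = froot mu z.
  by apply/eqP; rewrite root_connect // sym fconnect1.
set r := froot mu z; have rz : fconnect mu r z by rewrite sym connect_root.
have zE := iter_findex rz; have := findex_max rz.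
set k := findex mu r z in zE *; rewrite leq_eqVlt => /orP[/eqP kE|klt].
  have -> : mu z = r by rewrite -zE -iterS kE iter_order //; exact: perm_inj.
  rewrite findex0 -H0 -kE HS iterS zE -zE -iterS kE iter_order //.
  exact: perm_inj.
have -> : findex mu r (mu z) = k.+1 by rewrite -zE -iterS findex_iter.
by rewrite HS iterS zE.
Qed.

End Action.

(* In (2), gh' is allowed to be the identity, so sdact gh' mu' D' = D' replaces
   self_via gh' mu' D'; see cycle_condition_neq1 for when the two agree.
   The mathcomp product of permutations composes from left to right, so
   pi^-1 * mu * pi below is the map x |-> pi (mu (pi^-1 x)). *)
Theorem theorem4p4 (n : nat) (n_gt0 : 0 < n) (S : setsys n) (g : calG)
    (g_neq1 : g != 1) (mu : 'S_n) :
  [<-> exists D : setsys n, D \in Orb S /\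
         exists gh : {ffun 'I_n -> calG},
           [/\ gh = [ffun=> g],
               uniform gh &
               self_via gh mu D];
       forall D' : setsys n, D' \in Orb S ->
         exists (gh' : {ffun 'I_n -> calG}) (mu' : 'S_n),
           [/\ sdact gh' mu' D' = D',
               exists pi : 'S_n, mu' = pi^-1 * mu * pi &
               cycle_condition g gh' mu'];
       exists D' : setsys n, D' \in Orb S /\
         exists (gh' : {ffun 'I_n -> calG}) (mu' : 'S_n),
           [/\ self_via gh' mu' D',
               mu' = mu &
               cycle_condition g gh' mu']].
Proof.
have gN1 : [ffun=> g] != [ffun=> 1] :> {ffun 'I_n -> calG}.
  by apply: contra_neq g_neq1 => /ffunP/(_ (Ordinal n_gt0)); rewrite !ffunE.
tfae.
- case=> D [DS [_ [-> _ [_ gD]]]] D' D'S.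
  have [h [pi ->]] := Orb_trans DS D'S.
  pose nu := pi^-1 * mu * pi.
  pose f := [ffun x => h x * g * (h (nu^-1 x))^-1].
  have fE x : h x * g = f x * h (nu^-1 x) by rewrite ffunE mulgKV.
  exists f, nu; split; last exact: cycle_condition_conj fE.
    by rewrite (sdact_conj _ fE) gD.
  by exists pi.
- move=> /(_ S (Orb_refl S)) [f [nu [fS [pi nuE] cc]]].
  have [h hE] := cycle_condition_coboundary cc; rewrite nuE in fS hE.
  (* [f] may be the identity and [nu] is only conjugate to [mu], so (3) is witnessed by the constant
     map [g] on the pullback of [S]. *)
  pose D := sdact [ffun i => (h (pi i))^-1] pi^-1 S.
  have DS : sdact h pi D = S by exact: sdactKV.
  exists D; split; first exact/Orb_sdact/Orb_refl.
  exists [ffun=> g], mu; split=> //.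
    split=> //; apply: (can_inj (sdactK h pi)).
    by rewrite -(sdact_conj _ hE) DS.
  (* For the constant map [g], the trivial [h] solves the conjugation equation. *)
  apply: (@cycle_condition_conj _ _ [ffun=> 1]) => y.
  by rewrite !ffunE mul1g mulg1.
case=> D' [D'S [f [nu [[_ fD'] nuE cc]]]]; rewrite {nu}nuE in fD' cc.
have [h hE] := cycle_condition_coboundary cc.
(* The permutation is already [mu], so the conjugating element has trivial permutation part. *)
pose D := sdact [ffun i => (h ((1 : 'S_n) i))^-1] 1^-1 D'.
have DD' : sdact h 1 D = D' by exact: sdactKV.
exists D; split; first exact/Orb_sdact.
exists [ffun=> g]; split=> //; first by exists g.
split=> //; apply: (can_inj (sdactK h 1)).
have muE : 1^-1 * mu * 1 = mu by rewrite invg1 mul1g mulg1.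
by rewrite -(@sdact_conj _ f) ?muE // DD'.
Qed.
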